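(* Let $\kappa$ be an uncountable regular cardinal with $\kappa^{<\kappa}=\kappa$, and let $\mathbb{R}_\kappa$ be a $<\kappa$-closed version of $\kappa$-Mathias forcing with fusion. Let $\Gamma$ be a topologically reasonable family of subsets of $\kappa$-reals, i.e. $\Gamma$ is closed under continuous pre-images and intersections with closed sets. Then \[ \Gamma(\mathbb{R}_\kappa) \Rightarrow \Gamma(\mathrm{Baire}), \] that is, if every set in $\Gamma$ is $\mathbb{R}_\kappa$-measurable, then every set in $\Gamma$ has the Baire property.
   Context: $\kappa$-reals are elements of $\lambda^\kappa$ ($\lambda=2$ or $\lambda=\kappa$), with the topology generated by the sets $[s]=\{x\in\lambda^\kappa: s\subset x\}$, $s\in\lambda^{<\kappa}$. Subsets of $\kappa$ are identified with their characteristic functions in $2^\kappa$. $\kappa$-Mathias forcing. A version of $\kappa$-Mathias forcing is given by a nonempty family $\mathcal{A}\subseteq[\kappa]^\kappa$ (the further requirement on the sets $A$; e.g. all club subsets of $\kappa$, or the members of a normal measure on $\kappa$). Conditions are pairs $(s,A)$ with $s\subset\kappa$, $|s|<\kappa$, $A\in\mathcal{A}$ and $\sup(s)<\min(A)$; the order is $(t,B)\le(s,A)$ iff $t\supseteq s$, $t$ end-extends $s$, $B\subseteq A$ and $t\setminus s\subseteq A$. The condition $(s,A)$ is identified with the tree $T_{(s,A)}\subseteq 2^{<\kappa}$ of all initial segments of characteristic functions of sets $x\subseteq\kappa$ such that $x$ end-extends $s$ and $x\setminus s\subseteq A$; $[T]=\{x\in2^\kappa:\forall\alpha<\kappa\,(x{\upharpoonright}\alpha\in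 T)\}$ is the set of branches of a tree $T$. The forcing is a tree-forcing: if $T\in\mathbb{R}_\kappa$ and $t\in T$, then $T_t=\{s\in T: s\subseteq t\vee t\subseteq s\}\in\mathbb{R}_\kappa$. It is required to be $<\kappa$-closed (every decreasing sequence of conditions of length $<\kappa$ has a lower bound) and to have fusion, i.e. there are partial orders $\{\le_\alpha:\alpha<\kappa\}$ on it with $\le_0=\le$, $\le_\beta\subseteq\le_\alpha$ for $\alpha<\beta$, and such that whenever $p_\beta\le_\alpha p_\alpha$ for all $\alpha<\beta<\kappa$ there is $q$ with $q\le_\alpha p_\alpha$ for all $\alpha<\kappa$. Tree-measurability. For a tree-forcing $\mathbb{P}$ and a set $X$ of $\kappa$-reals: $X$ is $\mathbb{P}$-open dense iff $\forall T\in\mathbb{P}\,\exists T'\le T\,([T']\subseteq X)$; the complement of a $\mathbb{P}$-open dense set is $\mathbb{P}$-nowhere dense; $X$ is $\mathbb{P}$-meager if it is covered by a union of at most $\kappa$ many $\mathbb{P}$-nowhere dense sets; $\mathcal{I}_{\mathbb{P}}$ is the ideal of $\mathbb{P}$-meager sets. $X$ is $\mathbb{P}$-measurable iff for every $T\in\mathbb{P}$ there is $T'\le T$ such that $[T']\cap X\in\mathcal{I}_{\mathbb{P}}$ or $[T']\setminus X\in\mathcal{I}_{\mathbb{P}}$. The Baire property is $\mathbb{C}_\kappa$-measurability, where $\mathbb{C}_\kappa=(2^{<\kappa},\supseteq)$ is $\kappa$-Cohen forcing, with $s\in 2^{<\kappa}$ identified with the tree of nodes compatible with $s$ (set of branches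 $[s]$). $\Gamma(\mathbb{P})$ means that every set in $\Gamma$ is $\mathbb{P}$-measurable, and $\Gamma(\mathrm{Baire})$ means that every set in $\Gamma$ has the Baire property.
   Formalization: Γ has members in both 2^κ and κ^κ; a subset of κ^κ is measured via increasing enumerations of unbounded subsets of κ (with Γ only on 2^κ the claim is consistently false); sup(s)<min(A) is read elementwise, so that club κ-Mathias forcing is a tree-forcing. *)

(* Defs.v *)
From HB Require Import structures.
From mathcomp Require Import all_boot all_order.
From mathcomp Require Import boolp classical_sets functions cardinality.
From mathcomp Require Import topology.

Set Implicit Arguments.
Unset Strict Implicit.
Unset Printing Implicit Defensive.

Import Order.TTheory.
Local Open Scope order_scope.
Local Open Scope classical_set_scope.
Local Open Scope card_scope.

(** The cardinal kappa is a totally ordered type [K]; its elements are the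
    ordinals below kappa, and [a : K] also stands for the initial segment
    [[set b | b < a]]. *)

Record uncountable_regular_cardinal d (K : orderType d) : Prop := {
  kappa_wf : well_founded (fun a b : K => a < b);
  kappa_initial : forall a : K, ~~ ([set: K] #<= [set b : K | b < a]);
  kappa_regular : forall A : set K,
    (forall a, exists2 b, A b & a <= b) -> A #= [set: K];
  kappa_uncountable : ~ countable [set: K] }.

(** A sequence of length [a < kappa] is a partial function with domain
    [[set b | b < a]]. *)
Definition node d (K : orderType d) (L : Type) : set (K -> option L) :=
  [set s | exists a, forall b, isSome (s b) = (b < a)].
Arguments node {d} K L _.

Definition kappa_lt_kappa_eq_kappa d (K : orderType d) : Prop :=
  node K K #= [set: K].

Definition extends (I L : Type) (s t : I -> option L) : Prop :=
  forall b c, s b = Some c -> t b = Some c.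

Definition kreal d (K : orderType d) (L : Type) : Type := K -> L.

Definition initseg d (K : orderType d) (L : Type) (x : kreal K L) (a : K) :
  K -> option L := fun b => if b < a then Some (x b) else None.

Definition cone d (K : orderType d) (L : Type) (s : K -> option L) :
  set (kreal K L) := [set x | forall b c, s b = Some c -> x b = c].

(** This is the bounded topology, not the product topology that the library
    puts on [K -> L]. *)
HB.instance Definition _ d (K : orderType d) (L : Type) :=
  gen_eqMixin (kreal K L).
HB.instance Definition _ d (K : orderType d) (L : Type) :=
  gen_choiceMixin (kreal K L).
HB.instance Definition _ d (K : orderType d) (L : Type) :=
  isSubBaseTopological.Build (kreal K L)
    [set cone s | s in node K L] id.

Inductive lambda_base := Two | Kappa.

Definition base_type d (K : orderType d) (l : lambda_base) : Type :=
  match l with Two => bool | Kappa => K end.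

(** kappa-reals are elements of 2^kappa or of kappa^kappa; a family has members
    of both kinds. *)
Definition kfamily d (K : orderType d) : Type :=
  forall l : lambda_base, set (set (kreal K (base_type K l))).

Record topologically_reasonable d (K : orderType d) (G : kfamily K) : Prop := {
  reasonable_preimage : forall (l m : lambda_base)
      (f : kreal K (base_type K l) -> kreal K (base_type K m)),
    continuous f -> forall X, G m X -> G l (f @^-1` X);
  reasonable_closedI : forall (l : lambda_base) (C X : set (kreal K (base_type K l))),
    closed C -> G l X -> G l (X `&` C) }.

(** [tf_le q p] reads "q is stronger than p"; [tf_tree p] is the tree with
    which the condition [p] is identified. *)
Record forcing d (K : orderType d) := Forcing {
  tf_cond :> Type;
  tf_le : tf_cond -> tf_cond -> Prop;
  tf_tree : tf_cond -> set (K -> option bool) }.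

Definition branches d (K : orderType d) (T : set (K -> option bool)) :
  set (kreal K bool) := [set x | forall a : K, T (initseg x a)].

Definition tree_at (I : Type) (T : set (I -> option bool))
  (t : I -> option bool) : set (I -> option bool) :=
  [set s | T s /\ (extends s t \/ extends t s)].

Section Forcing.
Context d (K : orderType d) (P : forcing K).

Definition tree_forcing : Prop :=
  forall (p : P) t, tf_tree p t -> exists q : P, tf_tree q = tree_at (tf_tree p) t.

(** Only the values [f b] with [b < a] matter, so [f] is a sequence of
    length [a]. *)
Definition lt_kappa_closed : Prop :=
  forall (a : K) (f : K -> P),
    (forall b c, b <= c -> c < a -> tf_le (f c) (f b)) ->
    exists q : P, forall b, b < a -> tf_le q (f b).

Definition partial_order (T : Type) (R : T -> T -> Prop) : Prop :=
  [/\ forall x, R x x,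
      forall x y z, R x y -> R y z -> R x z &
      forall x y, R x y -> R y x -> x = y].

Definition has_fusion : Prop :=
  exists le_ : K -> P -> P -> Prop,
    [/\ forall a, partial_order (le_ a),
        forall o : K, (forall a, o <= a) ->
          forall q p, le_ o q p <-> tf_le q p,
        forall a b, a < b -> forall q p, le_ b q p -> le_ a q p &
        forall p : K -> P,
          (forall a b, a < b -> le_ a (p b) (p a)) ->
          exists q, forall a, le_ a q (p a)].

Definition forcing_open_dense (X : set (kreal K bool)) : Prop :=
  forall p : P, exists2 q : P, tf_le q p & branches (tf_tree q) `<=` X.

Definition forcing_nowhere_dense (X : set (kreal K bool)) : Prop :=
  forcing_open_dense (~` X).

(** The empty set is nowhere dense, so "at most kappa many" sets can be indexed
    by [K]. *)
Definition forcing_meager (X : set (kreal K bool)) : Prop :=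
  exists2 F : K -> set (kreal K bool),
    (forall a, forcing_nowhere_dense (F a)) & X `<=` \bigcup_a F a.

Definition forcing_measurable (X : set (kreal K bool)) : Prop :=
  forall p : P, exists2 q : P, tf_le q p &
    forcing_meager (branches (tf_tree q) `&` X) \/
    forcing_meager (branches (tf_tree q) `\` X).

End Forcing.

(** [f] is the increasing enumeration of (the set with characteristic
    function) [x]. *)
Definition enumerates d (K : orderType d) (f : kreal K K) (x : kreal K bool) :
  Prop :=
  (forall a b, a < b -> f a < f b) /\ (forall b, x b <-> exists a, f a = b).

(** Conditions are trees in 2^{<kappa}, so a set of kappa-reals is measured
    inside 2^kappa.  A subset of kappa^kappa is read there through the usual
    identification of the closed set of strictly increasing functions with
    [kappa]^kappa: an unbounded subset of kappa is its increasing
    enumeration. *)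
Definition in_cantor d (K : orderType d) (l : lambda_base) :
  set (kreal K (base_type K l)) -> set (kreal K bool) :=
  match l with
  | Two => fun X => X
  | Kappa => fun X => [set x | exists2 f, X f & enumerates f x]
  end.

Definition family_measurable d (K : orderType d) (G : kfamily K)
  (P : forcing K) : Prop :=
  forall l X, G l X -> forcing_measurable P (in_cantor X).

Definition cohen d (K : orderType d) : forcing K :=
  @Forcing d K {s : K -> option bool | node K bool s}
    (fun t s => extends (sval s) (sval t))
    (fun s => tree_at (node K bool) (sval s)).

Definition family_baire d (K : orderType d) (G : kfamily K) : Prop :=
  family_measurable G (cohen K).

Definition end_extends d (K : orderType d) (t s : set K) : Prop :=
  s `<=` t /\ forall a b, (t `\` s) a -> s b -> b < a.

(** sup(s) < min(A) is read elementwise, i.e. with sup(s) the least strict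
    upper bound and [<=].  With the least upper bound, [(s, A)] would be
    excluded when min(A) is a limit point of [s]; then the restrictions T_t of
    the trees would not be conditions in the club version. *)
Record mathias_cond d (K : orderType d) (calA : set (set K)) := MathiasCond {
  stem : set K;
  reservoir : set K;
  stem_small : ~~ ([set: K] #<= stem);
  reservoir_in : calA reservoir;
  stem_below : forall a b, stem a -> reservoir b -> a < b }.

Definition mathias_le d (K : orderType d) (calA : set (set K))
  (q p : mathias_cond calA) : Prop :=
  [/\ stem p `<=` stem q, end_extends (stem q) (stem p),
      reservoir q `<=` reservoir p & stem q `\` stem p `<=` reservoir p].

Definition charfun d (K : orderType d) (x : set K) : kreal K bool :=
  fun b => b \in x.

Definition mathias_tree d (K : orderType d) (calA : set (set K))
  (p : mathias_cond calA) : set (K -> option bool) :=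
  [set u | exists x : set K, exists a : K,
     [/\ end_extends x (stem p), x `\` stem p `<=` reservoir p &
         u = initseg (charfun x) a]].

Definition mathias d (K : orderType d) (calA : set (set K)) : forcing K :=
  Forcing (@mathias_le d K calA) (@mathias_tree d K calA).

Record mathias_version d (K : orderType d) (calA : set (set K)) : Prop := {
  mathias_nonempty : calA !=set0;
  mathias_unbounded : forall A, calA A -> A #= [set: K];
  mathias_tree_forcing : tree_forcing (mathias calA);
  mathias_closed : lt_kappa_closed (mathias calA);
  mathias_fusion : has_fusion (mathias calA) }.

(* Main.v *)
Require Import Defs.
From Stdlib Require List.
From mathcomp Require Import all_boot all_order.
From mathcomp Require Import boolp classical_sets functions cardinality.
From mathcomp Require Import finmap topology.
From mathcomp Require Import zify.

(** An increasing omega-sequence can be coloured by the elements of kappa so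
    that every unbounded set contains a sequence of every colour.  Cut the
    increasing enumeration of a Mathias real into consecutive blocks of length
    omega and read off the colours of the blocks: this gives an arbitrary
    element of kappa^kappa, which is turned into an increasing function and so
    into an unbounded subset of kappa, the set coded by the Mathias real.  The
    code is continuous on kappa^kappa, so the preimage Y of a set X in Gamma is
    measurable.  If Y is meager in a condition, covered by nowhere dense sets
    X_a, then stems of decreasing conditions avoiding X_a for more and more a
    can follow almost every Cohen real z, with limits taken by
    <kappa-closedness: off a meager set of z, there is a Mathias real in the
    condition that codes z and avoids all X_a, whence z is not in X. *)

Set Implicit Arguments.
Unset Strict Implicit.
Unset Printing Implicit Defensive.

Import Order.TTheory.
Local Open Scope order_scope.
Local Open Scope classical_set_scope.
Local Open Scope card_scope.

(** * The bounded topology *)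

Section Topology.
Context d (K : orderType d) (a0 : K).

Lemma initseg_node (L : Type) (x : kreal K L) (a : K) : node K L (initseg x a).
Proof. by exists a => b; rewrite /initseg; case: ifP. Qed.

Lemma node_initseg (L : Type) (s : K -> option L) (x : kreal K L) :
  node K L s -> cone s x -> exists a, s = initseg x a.
Proof.
move=> [a sa] sx; exists a; apply/funext => b; rewrite /initseg -sa.
by case E: (s b) => [c|] //=; rewrite (sx _ _ E).
Qed.

Lemma cone_initseg (L : Type) (x y : kreal K L) (a : K) :
  cone (initseg x a) y <-> forall b, b < a -> y b = x b.
Proof.
split=> [xy b ba|xy b c]; first by apply: xy; rewrite /initseg ba.
by rewrite /initseg; case: ifP => // ba [<-]; apply: xy.
Qed.

(** A finite intersection of cones around [x] contains the cone of the longest initial segment of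
    [x] involved, so these cones form a neighbourhood base. The point [a0] serves the empty
    intersection. *)
Lemma open_kreal (L : Type) (O : set (kreal K L)) :
  open O <-> forall x, O x -> exists a, cone (initseg x a) `<=` O.
Proof.
split=> [[D' D'D <-] x [B D'B Bx]|H].
  have [S SD SB] := D'D _ D'B.
  have InE (T : eqType) (s : T) r : List.In s r <-> s \in r.
    elim: r => //= t r ->; rewrite in_cons; split=> [[->|->]|/orP[/eqP->|]];
      rewrite ?eqxx ?orbT; by auto.
  have [r [rN rx rB]] : exists r : seq (set (kreal K L)),
      [/\ forall C, List.In C r -> exists2 s, node K L s & cone s = C,
          forall C, List.In C r -> C x &
          forall y, (forall C, List.In C r -> C y) -> B y].
    exists (enum_fset S); split=> [C /InE CS|C /InE CS|y yS].
    - by case: (set_mem (SD C CS)) => s sN sC; exists s.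
    - by move: Bx; rewrite -SB => Bx; exact: (Bx C).
    - by rewrite -SB => C CS; exact: (yS C (proj2 (InE _ _ _) CS)).
  suff [a aP] : exists a : K, forall C, List.In C r -> cone (initseg x a) `<=` C.
    by exists a => y xy; exists B => //; apply: rB => s sr; apply: aP xy.
  elim: r rN rx {rB} => [|C r IH] rN rx; first by exists a0.
  have [||a aP] := IH; [by move=> t tr; apply: rN; right|by move=> t tr; apply: rx; right|].
  have [s sN sC] := rN C (or_introl erefl).
  have [b sE] : exists b, s = initseg x b.
    by apply: node_initseg sN _; rewrite sC; apply: rx; left.
  exists (Order.max a b) => t [<-|tr] y /cone_initseg yx.
    by rewrite -sC sE; apply/cone_initseg => c cb; apply: yx; rewrite lt_max cb orbT.
  by apply/(aP _ tr)/cone_initseg => c cb; apply: yx; rewrite lt_max cb.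
pose D' := [set C | exists x a, C = cone (initseg x a) /\ C `<=` O].
exists D' => [_ [x [a [-> _]]]|].
  exists [fset cone (initseg x a)]%fset; last by rewrite set_fset1; exact: bigcap_set1.
  move=> s; rewrite !inE => /eqP->; apply: mem_set.
  by exists (initseg x a) => //; exact: initseg_node.
apply/seteqP; split=> [x [C [y [a [_ CO]]]] /CO //|x Ox].
have [a aO] := H _ Ox; exists (cone (initseg x a)); first by exists x, a.
exact/cone_initseg.
Qed.

Lemma continuous_kreal (L M : Type) (f : kreal K L -> kreal K M) :
  (forall x b, exists a, forall y, (forall c, c < a -> y c = x c) ->
     forall c, c < b -> f y c = f x c) -> continuous f.
Proof.
move=> H; apply/continuousP => O /open_kreal oO; apply/open_kreal => x /oO[b bO].
have [a aP] := H x b; exists a => y /cone_initseg yx; apply: bO.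
exact/cone_initseg/aP.
Qed.

End Topology.

(** * Transfinite recursion and enumerations *)

Section Order.
Context d (K : orderType d) (hK : uncountable_regular_cardinal K).

Lemma least_element (P : set K) : P !=set0 ->
  exists2 a, P a & forall b, P b -> a <= b.
Proof.
move=> [a Pa]; apply: contrapT => H; suff: ~ P a by [].
elim/(well_founded_ind (kappa_wf hK)): a {Pa} => a IH Pa; apply: H.
by exists a => // b Pb; rewrite leNgt; apply/negP => /IH.
Qed.

(** [Q a f t] reads: [t] is admissible at [a] after the values of [f] below [a]. Well-founded
    recursion chooses admissible values, and existence is demanded only after admissible earlier
    choices. *)
Lemma transfinite_choice (T : Type) (t0 : T) (Q : K -> (K -> T) -> T -> Prop) :
  (forall a f g t, (forall b, b < a -> f b = g b) -> Q a f t -> Q a g t) ->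
  (forall a f, (forall b, b < a -> Q b f (f b)) -> exists t, Q a f t) ->
  exists f, forall a, Q a f (f a).
Proof.
move=> Qloc Qex.
pose step a (r : forall b, b < a -> T) : T :=
  let f b := if pselect (b < a) is left ba then r b ba else t0 in
  if pselect (exists t, Q a f t) is left e then projT1 (cid e) else t0.
pose f := Fix (kappa_wf hK) (fun=> T) step.
have fE a : f a = step a (fun b _ => f b).
  apply: Fix_eq => b r r' rr'; congr step.
  by apply/functional_extensionality_dep => c; apply/functional_extensionality_dep => cb.
exists f; elim/(well_founded_ind (kappa_wf hK)) => a IH.
(* [g] is [f] cut off at [a] with default [t0], which is all that the recursion sees; locality of
   [Q] passes between the two. *)
rewrite fE /step; pose g b := if pselect (b < a) is left _ then f b else t0.
have gf b : b < a -> g b = f b by rewrite /g; case: pselect.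
have [t ft] := Qex a f IH.
rewrite -/g; case: pselect => [e|[]]; last by exists t; apply: Qloc ft => b /gf.
by apply: (Qloc _ _ _ _ gf); case: cid.
Qed.

(** Without a strict bound [A] is cofinal, hence of size kappa by regularity. *)
Lemma small_bounded (A : set K) : ~~ ([set: K] #<= A) ->
  exists a, forall b, A b -> b < a.
Proof.
move=> sA; apply: contrapT => /forallNP H; move/negP: sA; apply.
suff : A #= [set: K] by rewrite card_eq_le => /andP[].
apply: (kappa_regular hK) => a.
have /existsNP[b /not_implyP[Ab /negP]] := H a.
by rewrite -leNgt; exists b.
Qed.

Lemma image_bounded (h : K -> K) (a : K) : exists c, forall b, b < a -> h b < c.
Proof.
have [|c cP] := @small_bounded (h @` [set b | b < a]).
  apply: contra (kappa_initial hK a) => /card_le_trans; apply.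
  exact: card_image_le.
by exists c => b ba; apply: cP; exists b.
Qed.

(** Uncountability makes the range too small to be cofinal. *)
Lemma sequence_bounded (h : nat -> K) : exists c, forall n, h n < c.
Proof.
have [|c cP] := @small_bounded (range h).
  apply/negP => /card_le_trans /(_ (card_image_le _ _)).
  exact: kappa_uncountable hK.
by exists c => n; apply: cP; exists n.
Qed.

Lemma double_bounded (h : K -> nat -> K) (a : K) :
  exists c, forall b n, b < a -> h b n < c.
Proof.
have /choice[u uP] := fun b => sequence_bounded (h b).
have [c cP] := image_bounded u a.
by exists c => b n ba; apply: lt_trans (cP _ ba).
Qed.

Lemma kappa_inhabited : exists a : K, True.
Proof.
apply: contrapT => /forallNP H; apply: (kappa_uncountable hK).
by rewrite (_ : [set: K] = set0) // -subset0 => a; have := H a.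
Qed.

Lemma exists_gt (a : K) : exists b, a < b.
Proof. by have [c cP] := sequence_bounded (fun=> a); exists c; exact: (cP 0%N). Qed.

Definition is_lsub (A : set K) (a : K) : Prop :=
  (forall b, A b -> b < a) /\ forall c, (forall b, A b -> b < c) -> a <= c.

Lemma lsub_exists (A : set K) (c : K) : (forall b, A b -> b < c) ->
  exists a, is_lsub A a.
Proof.
move=> Ac; have [|a aA aP] := @least_element [set a | forall b, A b -> b < a].
  by exists c.
by exists a.
Qed.

(** * Unbounded sets and their increasing enumerations *)

Definition unbounded_set (A : set K) : Prop := forall a, exists2 b, A b & a < b.

Lemma unbounded_card (A : set K) : A #= [set: K] -> unbounded_set A.
Proof.
move=> AK a; apply: contrapT => H; have [b ab] := exists_gt a.
have /negP[] := kappa_initial hK b; apply: card_le_trans (subset_card_le (A := A) _).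
  by move: AK; rewrite card_eq_le => /andP[].
move=> c Ac; rewrite /= ltNge; apply/negP => bc; apply: H; exists c => //.
exact: lt_le_trans bc.
Qed.

Definition increasing (f : K -> K) : Prop := forall a b, a < b -> f a < f b.

Lemma increasing_ge (f : K -> K) : increasing f -> forall a, a <= f a.
Proof.
move=> fi; elim/(well_founded_ind (kappa_wf hK)) => a IH.
rewrite leNgt; apply/negP => faa; have := IH _ faa.
by rewrite leNgt (fi _ _ faa).
Qed.

Lemma increasing_lt (f : K -> K) a b : increasing f -> (f a < f b) = (a < b).
Proof.
move=> fi; apply/idP/idP => [|/fi//]; rewrite !ltNge; apply: contra.
by rewrite le_eqVlt => /orP[/eqP->//|/fi/ltW].
Qed.

Lemma increasing_inj (f : K -> K) : increasing f -> forall a b, f a = f b -> a = b.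
Proof.
by move=> fi a b fab; case: (ltgtP a b) => // /fi; rewrite fab ltxx.
Qed.

(** Each value is the least element of [A] above the earlier ones. Since [a <= f a], some value
    reaches any given [b] in [A], and the first one to do so is [b]. *)
Lemma enumeration_exists (A : set K) : unbounded_set A ->
  exists2 f : K -> K, increasing f & range f = A.
Proof.
move=> uA; have [a0 _] := kappa_inhabited.
have [||f fP] := @transfinite_choice K a0 (fun a f t =>
  [/\ A t, forall b, b < a -> f b < t &
      forall c, A c -> (forall b, b < a -> f b < c) -> t <= c]).
- move=> a f g t fg [At ft tm]; split=> // [b ba|c Ac gc].
    by rewrite -fg // ft.
  by apply: tm => // b ba; rewrite fg // gc.
- move=> a f _; have [c cP] := image_bounded f a; have [b Ab cb] := uA c.
  have [|t [At ft] tm] := @least_element [set t | A t /\ forall b, b < a -> f b < t].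
    by exists b; split=> // e /cP /lt_trans; apply.
  by exists t; split=> // e Ae fe; apply: tm.
have fi : increasing f by move=> a b ab; have [_ H _] := fP b; exact: H.
exists f => //; apply/seteqP; split=> [_ [a _ <-]|b Ab]; first by have [] := fP a.
have [|a ab am] := @least_element [set a | b <= f a].
  by exists b; exact: increasing_ge.
exists a => //; apply: le_anti; rewrite ab andbT.
have [_ _ ->//] := fP a => c ca; rewrite ltNge; apply/negP => /am.
by rewrite leNgt ca.
Qed.

(** The values of [f] below [a] form an initial segment of the range of [g], listed increasingly,
    and such a list is unique. This compares a partial enumeration, such as that of a stem, with a
    total one. *)
Lemma enumeration_unique (f g : K -> K) (a : K) :
  increasing g -> (forall b c, b < c -> c < a -> f b < f c) ->
  (forall b, b < a -> range g (f b)) ->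
  (forall c b, b < a -> g c <= f b -> exists2 e, e < a & f e = g c) ->
  forall b, b < a -> g b = f b.
Proof.
move=> gi fi fg fini; elim/(well_founded_ind (kappa_wf hK)) => b IH ba.
have [c _ gc] := fg b ba; have [cb|bc|cb] := ltgtP c b; last by rewrite -gc cb.
  by have := fi c b cb ba; rewrite -gc IH ?ltxx // (lt_trans cb).
have [|e ea fe] := fini b b ba; first by rewrite -gc; apply/ltW/gi.
have eb : e < b.
  rewrite ltNge le_eqVlt; apply/negP => /orP[/eqP eb|/fi/(_ ea)].
    by move: (gi _ _ bc); rewrite gc -fe eb ltxx.
  by rewrite fe -gc ltNge ltW // gi.
have := IH e eb ea; rewrite fe => /(increasing_inj gi) E.
by move: eb; rewrite E ltxx.
Qed.
End Order.

(** * Colouring omega-sequences *)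

Section Coloring.
Context d (K : orderType d) (hK : uncountable_regular_cardinal K).

Definition increasing_seq (h : nat -> K) : Prop := forall n, h n < h n.+1.

Lemma increasing_seqP (h : nat -> K) : increasing_seq h ->
  forall m n, (m < n)%N -> h m < h n.
Proof. by move=> hi m n; apply: (homo_ltn (@lt_trans _ K) hi). Qed.

Lemma increasing_seq_inj (h : nat -> K) : increasing_seq h -> injective h.
Proof.
move=> /increasing_seqP hi m n hmn; case: (ltngtP m n) => // /hi.
  by rewrite hmn ltxx.
by rewrite hmn ltxx.
Qed.

(** Fix a representative of each class of sequences that agree on tails up to a shift. If [y] is a
    tail of its representative, [f y] is the entry just before that tail. An increasing [a] shares a
    tail with its representative, and from there on [f] finds the predecessor. *)
Lemma tail_predecessor : exists f : (nat -> K) -> K,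
  forall a, increasing_seq a ->
  exists N, forall n, (N <= n)%N -> f (fun k => a (n + k).+1) = a n.
Proof.
have [a0 _] := kappa_inhabited hK.
pose teq (h h' : nat -> K) := exists m n, forall k, h (m + k)%N = h' (n + k)%N.
have teq_sym h h' : teq h h' -> teq h' h by move=> [m [n E]]; exists n, m => k.
have teq_trans h h' h'' : teq h h' -> teq h' h'' -> teq h h''.
  move=> [m [n E]] [m' [n' E']]; exists (m + m')%N, (n' + n)%N => k.
  by rewrite -addnA E addnCA E' addnA.
pose rep h := xget (fun=> a0) [set h' | teq h h'].
have rep_teq h : teq h (rep h).
  by apply: (@xgetPex _ _ [set h' | teq h h']); exists h; exists 0%N, 0%N.
have repE h h' : teq h h' -> rep h = rep h'.
  move=> hh'; rewrite /rep; congr xget; apply/seteqP.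
  by split=> g /=; apply: teq_trans => //; apply: teq_sym.
exists (fun y => if pselect (exists j, forall k, y k = rep y (j + k).+1) is left e
  then rep y (projT1 (cid e)) else a0).
move=> a ai; have [m [m' aE]] := rep_teq a; exists m => n mn.
set y := fun k => a (n + k).+1; have -> : rep y = rep a.
  by apply: repE; exists 0%N, n.+1 => k; rewrite /y addSn.
have yE k : y k = rep a ((m' + (n - m)) + k).+1.
  by rewrite -addnA -addnS -aE /y; congr a; lia.
case: pselect => [e|[]]; last by eexists; exact: yE.
case: cid => j /= jE0; have {jE0}jE k : y k = rep a (j + k).+1 := jE0 k.
(* The chosen position [j] is the expected one: [y] is injective, so it occurs as a tail at one
   position only. *)
suff -> : j = (m' + (n - m))%N by rewrite -aE subnKC.
have yi : injective y by move=> k l /(increasing_seq_inj ai); lia.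
have [jl|jl] := leqP j (m' + (n - m)).
  suff : (m' + (n - m) - j)%N = 0%N by lia.
  by apply: yi; rewrite [LHS]jE [RHS]yE; congr (rep a _); lia.
suff : (j - (m' + (n - m)))%N = 0%N by lia.
by apply: yi; rewrite [LHS]yE [RHS]jE; congr (rep a _); lia.
Qed.

(* Galvin and Prikry's proof that kappa does not satisfy the partition
   relation for omega-sequences with kappa colours. *)
Lemma universal_coloring : exists F : (nat -> K) -> K,
  forall A, unbounded_set A -> forall v, exists h,
    [/\ increasing_seq h, forall n, A (h n) & F h = v].
Proof.
have [f fP] := tail_predecessor.
(* It is enough to realize the colours in one unbounded [A] on all its unbounded subsets; the
   increasing enumeration of [A] then transports both sequences and colours to kappa. *)
suff [A uA AP] : exists2 A, unbounded_set A & forall Y, unbounded_set Y ->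
    Y `<=` A -> forall v, A v ->
    exists h, [/\ increasing_seq h, forall n, Y (h n) & f h = v].
  have [e ei eA] := enumeration_exists hK uA.
  have [a0 _] := kappa_inhabited hK.
  exists (fun h => xget a0 [set v | e v = f (e \o h)]) => B uB v.
  have [|||h [hi hB fh]] := AP (e @` B) _ _ (e v).
  - move=> a; have [b Bb ab] := uB a; exists (e b); first by exists b.
    exact: lt_le_trans (increasing_ge hK ei b).
  - by rewrite -eA => _ [b _ <-]; exists b.
  - by rewrite -eA; exists v.
  have /choice[g gP] : forall n, exists b, B b /\ e b = h n.
    by move=> n; have [b] := hB n; exists b.
  exists g; split=> [n|n|].
  - by rewrite -(increasing_lt _ _ ei) !(gP _).2.
  - by have [] := gP n.
  - have -> : e \o g = h by apply/funext => n; rewrite /= (gP n).2.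
    case: xgetP => [x _ /=|/(_ v) /=]; last by rewrite fh.
    by rewrite fh => /(increasing_inj ei).
apply: contrapT => H.
(* Otherwise every [A] has an unbounded subset that misses some colour taken from [A]; cutting the
   subset puts it above that colour. *)
have {}H (A : {A : set K | unbounded_set A}) :
  exists p : {Y : set K | unbounded_set Y} * K,
    [/\ sval p.1 `<=` sval A, sval A p.2, forall b, sval p.1 b -> p.2 < b &
        forall h, increasing_seq h -> (forall n, sval p.1 (h n)) -> f h <> p.2].
  apply: contrapT => /forallNP nP; apply: H; exists (sval A); first exact: svalP.
  move=> Y uY YA v Av; apply: contrapT => /forallNP nh.
  have uY' : unbounded_set [set b | Y b /\ v < b].
    move=> a; have [b Yb] := uY (Order.max a v); rewrite gt_max => /andP[ab vb].
    by exists b.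
  apply: (nP (exist _ _ uY', v)); split=> //= [b [/YA]|b []|h hi hY fh] //.
  by apply: (nh h); split=> // n; have [] := hY n.
have {H} [s sP] := choice H.
have uT : unbounded_set [set: K] by move=> a; have [b] := exists_gt hK a; exists b.
(* Iteration yields decreasing sets and an increasing sequence [v] of missed colours. A late tail of
   [v] lies in the next set, yet [f] sends it to the preceding, missed colour. *)
pose A := fix A n := if n is m.+1 then (s (A m)).1 else exist _ _ uT.
pose v n := (s (A n)).2.
have Av n : sval (A n) (v n) by have [] := sP (A n).
have AS n : sval (A n.+1) `<=` sval (A n) by have [] := sP (A n).
have Ale n k : sval (A (n + k)%N) `<=` sval (A n).
  by elim: k => [|k IH]; rewrite ?addn0 // addnS => b /AS; exact: IH.
have vi : increasing_seq v by move=> n; have [_ _ + _] := sP (A n); apply; exact: (Av n.+1).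
have [N /(_ N (leqnn _))] := fP v vi.
have [_ _ _] := sP (A N); apply; first by move=> n; rewrite addnS; exact: vi.
by move=> n; apply: (Ale N.+1 n); rewrite addSn; exact: Av.
Qed.

(** [pos a n] is the ordinal omega * a + n: block [a] starts at the least strict upper bound of the
    earlier blocks and continues by successors. *)
Lemma block_positions : exists pos : K -> nat -> K,
  [/\ forall a, increasing_seq (pos a),
      forall a b n, a < b -> pos a n < pos b 0%N &
      forall c, exists a n, pos a n = c].
Proof.
have [a0 _] := kappa_inhabited hK.
have /choice[succ succP] : forall a : K, exists b, a < b /\ forall c, a < c -> b <= c.
  by move=> a; have [b ab bm] := least_element hK (exists_gt hK a); exists b.
pose pos0 (w : K) n := iter n succ w.
have [||w wP] := @transfinite_choice _ _ hK K a0 (fun a w t =>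
  is_lsub [set c | exists2 b, b < a & exists n, c = pos0 (w b) n] t).
- move=> a f g t fg; congr is_lsub; apply/seteqP.
  by split=> _ [b ba [n ->]]; exists b => //; exists n; rewrite fg.
- move=> a f _; have [c cP] := double_bounded hK (fun b => pos0 (f b)) a.
  by apply: (@lsub_exists _ _ hK _ c) => _ [b ba [n ->]]; exact: cP.
exists (fun a => pos0 (w a)).
have winc a b n : a < b -> pos0 (w a) n < w b.
  by move=> ab; have [+ _] := wP b; apply; exists a => //; exists n.
split=> [a n|a b n /winc|c] //; first by have [] := succP (pos0 (w a) n).
have wi : increasing w by move=> a b; exact: (@winc a b 0%N).
have [|a ca am] := @least_element _ _ hK [set a | c < w a].
  by have [b cb] := exists_gt hK c; exists b; exact: lt_le_trans (increasing_ge hK wi b).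
(* As [c] lies below the start of block [a], an earlier block reaches [c]; by minimality of [a] that
   block starts at or below [c], so descending along it hits [c]. *)
have [b [n [ba cn]]] : exists b n, b < a /\ c <= pos0 (w b) n.
  apply: contrapT => H; have [_ /(_ c)] := wP a; rewrite leNgt ca => F.
  suff : false by []; apply: F => _ [b ba [n ->]]; rewrite ltNge; apply/negP => cn.
  by apply: H; exists b, n.
have wc : w b <= c by rewrite leNgt; apply/negP => /am; rewrite leNgt ba.
exists b; elim: n cn => [|n IH] cn.
  by exists 0%N; apply: le_anti; rewrite cn wc.
have [/IH//|nc] := leP c (pos0 (w b) n); exists n.+1; apply: le_anti; rewrite cn andbT.
by have [_] := succP (pos0 (w b) n); apply.
Qed.

(** [G v] keeps [v a] when it exceeds all earlier values of [G v], and otherwise takes their least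
    strict upper bound. In particular increasing functions are fixed. *)
Lemma straightening : exists G : (K -> K) -> K -> K,
  [/\ forall v, increasing (G v),
      forall a u v, (forall b, b < a -> u b = v b) ->
        forall b, b < a -> G u b = G v b &
      forall v b, (forall c, c < b -> G v c < v b) -> G v b = v b].
Proof.
have [a0 _] := kappa_inhabited hK.
have /choice[G GP] : forall v, exists g : K -> K, forall a,
    if `[< forall b, b < a -> g b < v a >] then g a = v a
    else is_lsub [set g b | b in [set b | b < a]] (g a).
  move=> v; apply: (@transfinite_choice _ _ hK K a0 (fun a g t =>
    if `[< forall b, b < a -> g b < v a >] then t = v a
    else is_lsub [set g b | b in [set b | b < a]] t)).
    move=> a f g t fg.
    have -> : [set f b | b in [set b | b < a]] = [set g b | b in [set b | b < a]].
      by apply/seteqP; split=> _ [b ba <-]; exists b => //; rewrite fg.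
    have -> // : `[< forall b, b < a -> f b < v a >] = `[< forall b, b < a -> g b < v a >].
    by apply: asbool_equiv_eq; split=> H b ba; [rewrite -fg|rewrite fg] => //; exact: H.
  move=> a f _; case: asboolP => _; first by exists (v a).
  have [c cP] := image_bounded hK f a.
  by apply: (@lsub_exists _ _ hK _ c) => _ [b ba <-]; exact: cP.
have Gi v : increasing (G v).
  move=> b a ba; have := GP v a; case: asboolP => [H ->|_ [+ _]]; first exact: H.
  by apply; exists b.
exists G; split=> // [a u v uv|v b H]; last first.
  by have := GP v b; case: asboolP.
elim/(well_founded_ind (kappa_wf hK)) => b IH ba.
have {}IH c : c < b -> G u c = G v c by move=> cb; apply: IH => //; exact: lt_trans ba.
have := GP u b; have := GP v b.
have -> : [set G u c | c in [set c | c < b]] = [set G v c | c in [set c | c < b]].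
  by apply/seteqP; split=> _ [c cb <-]; exists c => //; rewrite IH.
have -> : `[< forall c, c < b -> G u c < u b >] = `[< forall c, c < b -> G v c < v b >].
  apply: asbool_equiv_eq; split=> H c cb; have := H c cb; rewrite uv // IH //.
case: asboolP => _; first by move=> -> ->; exact: uv.
move=> [vB vm] [uB um]; apply: le_anti; rewrite um //=; exact: vm.
Qed.
End Coloring.

(** * Comeager sets of Cohen reals *)

Section Cohen.
Context d (K : orderType d) (hK : uncountable_regular_cardinal K).

Lemma branches_tree_at (q : K -> option bool) :
  node K bool q -> branches (tree_at (node K bool) q) = cone q.
Proof.
move=> qn; apply/seteqP; split=> z zq; last first.
  move=> a; split; first exact: initseg_node.
  have [c ->] := node_initseg qn zq; have [ac|ca] := leP a c.
    left=> b v; rewrite /initseg; case: ifP => // ba <-.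
    by rewrite (lt_le_trans ba).
  right=> b v; rewrite /initseg; case: ifP => // bc <-.
  by rewrite (lt_trans bc).
move=> b v qb; have [c bc] := exists_gt hK b.
have [_ [zc|qz]] := zq c.
  by apply: Some_inj; rewrite -qb; symmetry; apply: zc; rewrite /initseg bc.
by have := qz _ _ qb; rewrite /initseg bc => -[].
Qed.

Lemma maximal_antichain (S : Type) (sg : S -> K -> option bool) (P : set S) :
  exists A : set S, [/\ A `<=` P,
    forall s t z, A s -> A t -> cone (sg s) z -> cone (sg t) z -> s = t &
    forall s, P s -> exists t z, [/\ A t, cone (sg s) z & cone (sg t) z]].
Proof.
have [F FP tF|A [[AP Aanti] Amax]] := @Zorn_bigcup S
  [set A | A `<=` P /\ forall s t z, A s -> A t -> cone (sg s) z -> cone (sg t) z -> s = t].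
  split=> [s [A FA As]|s t z [A FA As] [B FB Bt]]; first exact: (FP _ FA).1 _ As.
  have [AB|BA] := tF _ _ FA FB.
    by apply: (FP _ FB).2 => //; exact: AB.
  by apply: (FP _ FA).2 => //; exact: BA.
exists A; split=> // s Ps; apply: contrapT => nA.
have nAs t z : A t -> cone (sg s) z -> ~ cone (sg t) z.
  by move=> At sz tz; apply: nA; exists t, z.
(* Cones are nonempty, so a cone disjoint from all those of [A] belongs to a new element, against
   maximality. *)
have sz : cone (sg s) (fun b => odflt false (sg s b)) by move=> b c ->.
apply: (Amax (A `|` [set s])).
  by split=> [|/(_ s (or_intror erefl)) As]; [left|exact: (nAs _ _ As sz sz)].
split=> [t [/AP//|->//]|t u z [At|->] [Au|->] //] tz uz; first exact: Aanti tz uz.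
  by case: (nAs _ _ At uz).
by case: (nAs _ _ Au tz).
Qed.

(** A descending sequence of states is built along each [z]: at stage [a], take a lower bound of the
    earlier states, then the member of a fixed maximal antichain of [Next] states whose cone
    contains [z]. The reals that first fail at stage [a] form a nowhere dense set. *)
Lemma cohen_fusion (S : Type) (le : S -> S -> Prop) (sg : S -> K -> option bool)
    (Next : K -> S -> S -> Prop) (s0 : S) :
  (forall s, node K bool (sg s)) ->
  (forall s, le s s) -> (forall s t u, le s t -> le t u -> le s u) ->
  (forall s t, le t s -> cone (sg t) `<=` cone (sg s)) ->
  (forall a s t, Next a s t -> le t s) ->
  (forall a s z c, cone (sg s) z ->
     exists2 t, Next a s t & cone (sg t) `<=` cone (initseg z c)) ->
  (forall (a : K) (f : K -> S), (exists b, b < a) ->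
     (forall b c, b <= c -> c < a -> le (f c) (f b)) ->
     exists l, (forall b, b < a -> le l (f b)) /\
       forall z, (forall b, b < a -> cone (sg (f b)) z) -> cone (sg l) z) ->
  exists N : K -> set (kreal K bool),
    (forall a, forcing_nowhere_dense (cohen K) (N a)) /\
    forall z, cone (sg s0) z -> ~ (\bigcup_a N a) z ->
    exists f : K -> S, [/\ forall b c, b <= c -> le (f c) (f b),
      forall a, le (f a) s0,
      forall a, exists l, Next a l (f a) & forall a, cone (sg (f a)) z].
Proof.
move=> sgN le_refl le_trans le_cone Next_le Next_dense le_closed.
have [Anti AntiP] : exists Anti : K -> S -> set S, forall a s,
    [/\ Anti a s `<=` Next a s,
    forall t u z, Anti a s t -> Anti a s u -> cone (sg t) z -> cone (sg u) z -> t = u &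
    forall t, Next a s t -> exists u z, [/\ Anti a s u, cone (sg t) z & cone (sg u) z]].
  have /choice[A AP] := fun p : K * S => maximal_antichain sg (Next p.1 p.2).
  by exists (fun a s => A (a, s)) => a s; exact: AP (a, s).
(* Choosing from a set of states, and not along [z], gives two reals with the same history the same
   limit. *)
have [pick pickP] : exists pick : set S -> S, forall P l, P l -> P (pick P).
  suff /choice[pick pickP] : forall P : set S, exists l, forall l', P l' -> P l.
    by exists pick => P l; exact: pickP.
  move=> P; have [[l Pl]|nP] := pselect (exists l, P l); first by exists l.
  by exists s0 => l Pl; case: nP; exists l.
(* The clauses on [s0] cover the first stage, where [s0] itself is a lower bound. *)
pose lower (a : K) (f : K -> S) l := [/\ forall b, b < a -> le l (f b), le l s0 &
  forall z, cone (sg s0) z -> (forall b, b < a -> cone (sg (f b)) z) -> cone (sg l) z].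
pose Lim a f := pick (lower a f).
have Lim_eq a f g : (forall b, b < a -> f b = g b) -> Lim a f = Lim a g.
  move=> fg; congr pick; apply/seteqP; split=> l [h1 h2 h3].
    split=> // [b ba|z z0 gz]; [by rewrite -fg //; exact: h1|].
    by apply: h3 => // b ba; rewrite fg //; exact: gz.
  split=> // [b ba|z z0 gz]; [by rewrite fg //; exact: h1|].
  by apply: h3 => // b ba; rewrite -fg //; exact: gz.
(* The second alternative only keeps the recursion total; a stage of that kind is a failure. *)
pose Q z a f t := (Anti a (Lim a f) t /\ cone (sg t) z) \/
  ((forall u, Anti a (Lim a f) u -> ~ cone (sg u) z) /\ t = Lim a f).
have /choice[R RP] : forall z, exists f : K -> S, forall a, Q z a f (f a).
  move=> z; apply: (transfinite_choice hK s0) => [a f g t fg|a f _].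
    by rewrite /Q (Lim_eq _ _ _ fg).
  have [[t tP]|nt] := pselect (exists t, Anti a (Lim a f) t /\ cone (sg t) z).
    by exists t; left.
  by exists (Lim a f); right; split=> // u Au uz; apply: nt; exists u.
pose ok z a := Anti a (Lim a (R z)) (R z a) /\ cone (sg (R z a)) z.
have R_le z a : le (R z a) (Lim a (R z)).
  have [[A1 _]|[_ ->]] := RP z a; last exact: le_refl.
  by have [/(_ _ A1)/Next_le] := AntiP a (Lim a (R z)).
have LimP z a : cone (sg s0) z -> (forall b, b < a -> ok z b) ->
    lower a (R z) (Lim a (R z)).
  move=> z0; elim/(well_founded_ind (kappa_wf hK)): a => a IH okz.
  have {}IH b : b < a -> lower b (R z) (Lim b (R z)).
    by move=> ba; apply: IH => // c cb; apply: okz; exact: lt_trans ba.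
  have [ex|nex] := pselect (exists b : K, b < a); last first.
    by apply: (pickP _ s0); split=> // b ba; case: nex; exists b.
  have [||l [l1 l2]] := le_closed a (R z) => //.
    move=> b c; rewrite le_eqVlt => /orP[/eqP-> _|bc ca]; first exact: le_refl.
    by apply: (le_trans _ _ _ (R_le z c)); have [h _ _] := IH c ca; exact: h.
  apply: (pickP _ l); split=> // [|z' _]; last exact: l2.
  have [b ba] := ex; apply: (le_trans _ _ _ (l1 b ba)); apply: (le_trans _ _ _ (R_le z b)).
  by have [] := IH b ba.
exists (fun a => [set z | [/\ cone (sg s0) z, forall b, b < a -> ok z b & ~ ok z a]]).
split=> [a p|z z0 zN]; last first.
  have okz a : ok z a.
    elim/(well_founded_ind (kappa_wf hK)): a => a IH; apply: contrapT => nok.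
    by apply: zN; exists a.
  have LP a : lower a (R z) (Lim a (R z)) by apply: LimP => // b _.
  exists (R z); split=> [b c|a|a|a].
  - rewrite le_eqVlt => /orP[/eqP->|bc]; first exact: le_refl.
    by apply: (le_trans _ _ _ (R_le z c)); have [h _ _] := LP c; exact: h.
  - by apply: (le_trans _ _ _ (R_le z a)); have [] := LP a.
  - exists (Lim a (R z)); have [A1 _] := okz a.
    by have [h _ _] := AntiP a (Lim a (R z)); exact: h.
  - by have [] := okz a.
case: p => p pN; set N := [set _ | _].
have [[z [pz [z0 okz nok]]]|nz] := pselect (exists z, cone p z /\ N z); last first.
  exists (exist _ p pN) => //= z; rewrite branches_tree_at // => pz Nz.
  by apply: nz; exists z.
have LP := LimP _ _ z0 okz; set l := Lim a (R z) in LP *.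
have lz : cone (sg l) z by have [_ _] := LP; apply => // b ba; have [] := okz b ba.
have [c0 pE] := node_initseg pN pz; have [c1 lE] := node_initseg (sgN l) lz.
(* Some [t] follows [z] beyond [p] and [l], and by maximality an antichain member [u] is compatible
   with it. The stronger condition is a part of a common branch [z'] long enough to enter the cone
   of [u]. *)
have [t tN tz] := Next_dense a l z (Order.max c0 c1) lz.
have [_ Anti_inj Anti_max] := AntiP a l.
have [u [z' [Au tz' uz']]] := Anti_max t tN.
have [c2 uE] := node_initseg (sgN u) uz'.
pose c := Order.max (Order.max c0 c1) c2.
have zz' : forall b, b < Order.max c0 c1 -> z' b = z b by apply/cone_initseg/tz.
exists (exist _ (initseg z' c) (initseg_node z' c)) => /=.
  rewrite pE => b v; rewrite /initseg; case: ifP => // bc <-.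
  by rewrite !lt_max bc /= zz' // lt_max bc.
move=> y; rewrite branches_tree_at; last exact: initseg_node.
move=> /cone_initseg yz' [y0 oky noky].
have yl : cone (sg l) y.
  rewrite lE; apply/cone_initseg => b bc.
  by rewrite yz' ?zz' // !lt_max bc ?orbT.
have yu : cone (sg u) y.
  by rewrite uE; apply/cone_initseg => b bc; rewrite yz' // !lt_max bc ?orbT.
(* At each earlier stage both states lie in the same antichain and have [y] in their cones, so they
   are equal. Hence [u] catches [y] at stage [a]. *)
have Rzy b : b < a -> R z b = R y b.
  elim/(well_founded_ind (kappa_wf hK)): b => b IH ba.
  have Lzy : Lim b (R z) = Lim b (R y).
    by apply: Lim_eq => e eb; apply: IH => //; exact: lt_trans ba.
  have [Ab _] := okz b ba; have [Ab' yb'] := oky b ba.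
  have [_ inj _] := AntiP b (Lim b (R z)); apply: (inj _ _ y) => //.
    by rewrite Lzy.
  by apply: le_cone yl; have [h _ _] := LP; exact: h.
have ly : l = Lim a (R y) by exact: Lim_eq.
have [//|[noA _]] := RP y a; by apply: (noA u) => //; rewrite -ly.
Qed.
End Cohen.

(** * Mathias conditions *)

Section Mathias.
Context d (K : orderType d) (hK : uncountable_regular_cardinal K).
Context (calA : set (set K)) (hA : mathias_version calA).
Implicit Types (p q r : mathias_cond calA) (x y : set K).

(** Bounded [x] are allowed, so that stems of stronger conditions are included. *)
Definition mathias_real p x : Prop :=
  end_extends x (stem p) /\ x `\` stem p `<=` reservoir p.

Lemma mathias_real_branch p x :
  mathias_real p x -> branches (mathias_tree p) (charfun x).
Proof. by move=> [? ?] a; exists x, a. Qed.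

Lemma mathias_tree_initseg p y c : mathias_tree p (initseg (charfun y) c) <->
  exists2 x, mathias_real p x & forall b, b < c -> (x b <-> y b).
Proof.
split=> [[x [e [px1 px2 E]]]|[x [px1 px2] xy]].
  exists x => // b bc; have := congr1 (@^~ b) E; rewrite /initseg bc.
  case: ifP => // _ [/esym bE].
  by rewrite -(in_setE x b) -(in_setE y b); move: bE; rewrite /charfun => ->.
exists x, c; split=> //; apply/funext => b; rewrite /initseg.
case: ifP => // bc; congr Some; rewrite /charfun.
by apply/idP/idP => /set_mem /(xy b bc) /mem_set.
Qed.

Lemma compatible_initseg x y a c : a <= c ->
  (extends (initseg (charfun y) c) (initseg (charfun x) a) \/
   extends (initseg (charfun x) a) (initseg (charfun y) c)) <->
  forall b, b < a -> (y b <-> x b).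
Proof.
move=> ac; split=> [H b ba|H].
  have bc := lt_le_trans ba ac.
  suff E : (b \in x) = (b \in y) by rewrite -(in_setE x b) -(in_setE y b) E.
  case: H => [/(_ b (b \in y))|/(_ b (b \in x))]; rewrite /initseg ba bc => /(_ erefl).
    by case.
  by case.
right=> b v; rewrite /initseg; case: ifP => // ba [<-]; rewrite (lt_le_trans ba ac).
congr Some; rewrite /charfun.
by apply/idP/idP => /set_mem /(H b ba) /mem_set.
Qed.

Lemma end_extends_trans x y (s : set K) :
  end_extends x y -> end_extends y s -> end_extends x s.
Proof.
move=> [yx xy] [sy ys]; split=> [b /sy/yx//|a b [xa sa] sb].
have [ya|nya] := pselect (y a); first exact: ys.
by apply: xy => //; exact: sy.
Qed.

Lemma mathias_real_le p q x : mathias_le q p -> mathias_real q x -> mathias_real p x.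
Proof.
move=> [pq qp rqp qr] [xq xr]; split; first exact: end_extends_trans xq qp.
move=> b [xb nb]; have [qb|nqb] := pselect (stem q b); first exact: qr.
by apply/rqp/xr.
Qed.

Lemma mathias_le_real q p :
  mathias_real p (stem q) -> reservoir q `<=` reservoir p -> mathias_le q p.
Proof. by move=> [[h1 h2] h3] h4; split. Qed.

Lemma mathias_real_stem p : mathias_real p (stem p).
Proof. by split=> [|b []//]; split=> // a b []. Qed.

Lemma mathias_le_refl p : mathias_le p p.
Proof. by apply: mathias_le_real => //; exact: mathias_real_stem. Qed.

Lemma mathias_le_trans p q r : mathias_le r q -> mathias_le q p -> mathias_le r p.
Proof.
move=> rq qp; apply: mathias_le_real.
  apply: mathias_real_le qp _; have [h1 h2 h3 h4] := rq; by split.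
by have [_ _ h _] := rq; have [_ _ h' _] := qp; move=> b /h/h'.
Qed.

Lemma mathias_le_branches p q : mathias_le q p ->
  branches (mathias_tree q) `<=` branches (mathias_tree p).
Proof.
move=> qp z zq a; have [x [c [h1 h2 ->]]] := zq a.
by exists x, c; have [] := mathias_real_le qp (conj h1 h2).
Qed.

Lemma mathias_real_below p x a : mathias_real p x ->
  (forall b, stem p b -> b < a) -> mathias_real p (x `&` [set b | b < a]).
Proof.
move=> [[px xp] xr] pa; split; last by move=> b [[xb _] nb]; apply: xr.
split=> [b pb|b c [[xb _] nb] pc]; first by split; [exact: px|exact: pa].
by apply: xp.
Qed.

(** The tree restricted to the node of [x] at [a] belongs to a condition [q]. Being a tree-forcing
    gives only an equality of trees, so the stem of [q] and the order are read back from its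
    tree. *)
Lemma mathias_cut p x a : mathias_real p x -> (forall b, stem p b -> b < a) ->
  exists2 q, mathias_le q p & stem q = x `&` [set b | b < a].
Proof.
move=> px pa; have px' := mathias_real_below px pa.
have [|q qE] := mathias_tree_forcing hA (p := p) (t := initseg (charfun x) a).
  by apply/mathias_tree_initseg; exists x.
have qP y c : a <= c -> mathias_tree q (initseg (charfun y) c) <->
    mathias_tree p (initseg (charfun y) c) /\ forall b, b < a -> (y b <-> x b).
  move=> ac; have : mathias_tree q = tree_at (mathias_tree p) (initseg (charfun x) a) by [].
  by move->; rewrite /tree_at /=; have := compatible_initseg x y ac; tauto.
have qx b : b < a -> (stem q b <-> x b).
  have : mathias_tree q (initseg (charfun (stem q)) a).
    by apply/mathias_tree_initseg; exists (stem q) => //; exact: mathias_real_stem.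
  by move=> /(qP _ _ (lexx a))[_]; apply.
(* Nothing in the stem of [q] lies at or above [a], since the initial segment of [x] is itself a
   node of the restricted tree at every length. *)
have sE : stem q = x `&` [set b | b < a].
  apply/seteqP; split=> [b qb|b [xb ba]]; last exact/qx.
  have [c] := exists_gt hK (Order.max a b); rewrite gt_max => /andP[/ltW ac bc].
  have : mathias_tree q (initseg (charfun (x `&` [set b | b < a])) c).
    apply/qP => //; split; last by move=> e ea; split=> [[]|].
    by apply/mathias_tree_initseg; exists (x `&` [set b | b < a]).
  move=> /mathias_tree_initseg [y [[qy _] _] /(_ b bc) <-]; exact: qy.
exists q => //; apply: mathias_le_real; first by rewrite sE.
(* One reservoir element added to the stem already shows, through a node beyond it, that it belongs
   to the reservoir of [p]. *)
move=> b qb; pose y := stem q `|` [set b].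
have qy : mathias_real q y.
  split=> [|c [[//|->//]]]; split=> [c|c e]; first by left.
  by move=> [[//|-> _] qe]; exact: stem_below qe qb.
have [c] := exists_gt hK (Order.max a b); rewrite gt_max => /andP[/ltW ac bc].
have : mathias_tree q (initseg (charfun y) c) by apply/mathias_tree_initseg; exists y.
move=> /(qP _ _ ac)[/mathias_tree_initseg [x' [_ px'r] x'y] _].
apply: px'r; split; first by apply/x'y => //; right.
move=> pb; suff : stem q b by move=> /stem_below/(_ qb); rewrite ltxx.
by rewrite sE; have [[h _] _] := px'; exact: h.
Qed.
End Mathias.

(** * Coding Cohen reals by Mathias reals *)

Section States.
Context d (K : orderType d) (hK : uncountable_regular_cardinal K).
Context (calA : set (set K)) (hA : mathias_version calA).
Context (F : (nat -> K) -> K) (pos : K -> nat -> K) (G : (K -> K) -> K -> K).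
Context (F_onto : forall A, unbounded_set A -> forall v, exists h,
  [/\ increasing_seq h, forall n, A (h n) & F h = v]).
Context (pos_seq : forall a, increasing_seq (pos a)).
Context (pos_block : forall a b n, a < b -> pos a n < pos b 0%N).
Context (pos_onto : forall c, exists a n, pos a n = c).
Context (G_increasing : forall v, increasing (G v)).
Context (G_local : forall a u v, (forall b, b < a -> u b = v b) ->
  forall b, b < a -> G u b = G v b).
Context (G_id : forall v b, (forall c, c < b -> G v c < v b) -> G v b = v b).
Implicit Types (f u v : K -> K) (a b c : K).

Definition colors f : K -> K := fun b => F (f \o pos b).

Definition coded f : set K := range (G (colors f)).

Let start a : K := pos a 0%N.

Lemma start_increasing : increasing start.
Proof. by move=> a b; exact: (@pos_block a b 0%N). Qed.

Lemma start_ge a n : start a <= pos a n.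
Proof. by case: n => // n; apply/ltW/(increasing_seqP (pos_seq a)). Qed.

Lemma start_mono a b : a <= b -> start a <= start b.
Proof. by rewrite le_eqVlt => /orP[/eqP->//|/start_increasing/ltW]. Qed.

Lemma lt_startP c a : c < start a -> exists2 b, b < a & exists n, pos b n = c.
Proof.
move=> ca; have [b [n bn]] := pos_onto c; exists b; last by exists n.
rewrite ltNge; apply/negP => ab; move: ca; rewrite ltNge -bn => /negP; apply.
exact: le_trans (start_mono ab) (start_ge b n).
Qed.

Lemma le_start a : a <= start a.
Proof. exact: (increasing_ge hK start_increasing). Qed.

Lemma colors_local f g a : (forall c, c < start a -> f c = g c) ->
  forall b, b < a -> colors f b = colors g b.
Proof. by move=> fg b ba; congr F; apply/funext => n; apply/fg/pos_block. Qed.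

(** As [G u] increases, its values up to [G u b] have indices at most [b], where [u] and [v]
    agree. *)
Lemma G_range u v a b c : (forall e, e < a -> u e = v e) -> b < a ->
  c <= G u b -> range (G u) c -> range (G v) c.
Proof.
move=> uv ba cb [e _ ec]; exists e => //; rewrite -(G_local uv) //.
move: cb; rewrite -ec leNgt => eb; apply: le_lt_trans ba.
by rewrite leNgt; apply: contra eb; exact: G_increasing.
Qed.

Lemma G_range_eq u v a b c : (forall e, e < a -> u e = v e) -> b < a ->
  c <= G u b -> `[< range (G u) c >] = `[< range (G v) c >].
Proof.
move=> uv ba cb; apply: asbool_equiv_eq; split; first exact: G_range uv ba cb.
apply: (@G_range v u a b) => // [e /uv//|].
by rewrite -(G_local uv).
Qed.

(* The stem has order type omega * len, so that it determines the first len
   elements of the coded set. *)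
Record state := State {
  cond : mathias_cond calA;
  len : K;
  enum : K -> K;
  stemE : stem cond = [set enum b | b in [set b | b < start len]];
  enum_lt : forall b c, b < c -> c < start len -> enum b < enum c }.

Definition state_le t s : Prop :=
  [/\ mathias_le (cond t) (cond s), len s <= len t &
      forall b, b < start (len s) -> enum t b = enum s b].

(** The part of the coded Cohen real settled by the completed blocks; values of [enum s] from
    [start (len s)] on have no influence. *)
Definition decided s : K -> option bool := fun c =>
  if `[< exists2 b, b < len s & c <= G (colors (enum s)) b >]
  then Some `[< coded (enum s) c >] else None.

Lemma cone_decided s z : cone (decided s) z <->
  forall b c, b < len s -> c <= G (colors (enum s)) b -> z c = `[< coded (enum s) c >].
Proof.
split=> [sz b c bs cb|H c e].
  apply: sz; rewrite /decided; case: asboolP => // -[]; by exists b.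
by rewrite /decided; case: asboolP => // -[b bs cb] [<-]; exact: H bs cb.
Qed.

Lemma decided_node s : node K bool (decided s).
Proof.
have [c0 cP] := image_bounded hK (G (colors (enum s))) (len s).
have [|a na am] := least_element hK (P :=
  [set c | ~ exists2 b, b < len s & c <= G (colors (enum s)) b]).
  by exists c0 => -[b /cP]; rewrite ltNge => /negP.
exists a => c; rewrite /decided; case: asboolP => [[b bs cb]|nc] /=.
  apply/esym; rewrite ltNge; apply/negP => ac; apply: na; exists b => //.
  exact: le_trans cb.
by apply/esym/negbTE; rewrite -leNgt; exact: am.
Qed.

Lemma state_le_refl s : state_le s s.
Proof. by split=> //; exact: mathias_le_refl. Qed.

Lemma state_le_trans s t r : state_le s t -> state_le t r -> state_le s r.
Proof.
move=> [st tls est] [tr rlt etr]; split=> [||b br]; first exact: mathias_le_trans tr.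
  exact: le_trans tls.
by rewrite est ?etr // (lt_le_trans br) // start_mono.
Qed.

Lemma state_le_cone s t : state_le t s -> cone (decided t) `<=` cone (decided s).
Proof.
move=> [_ st ets] z /cone_decided tz; apply/cone_decided => b c bs cb.
have H : forall e, e < len s -> colors (enum s) e = colors (enum t) e.
  by apply: colors_local => e es; rewrite ets.
rewrite (@tz b) ?(G_range_eq H bs) //; first exact: lt_le_trans st.
by rewrite -(G_local H).
Qed.

Lemma reservoir_unbounded (p : mathias_cond calA) : unbounded_set (reservoir p).
Proof. exact: (unbounded_card hK (mathias_unbounded hA (reservoir_in p))). Qed.

Lemma stem_bounded (p : mathias_cond calA) : exists a, forall b, stem p b -> b < a.
Proof. exact: (small_bounded hK (stem_small p)). Qed.

(** The stem of [q] may stop inside a block. Stem and reservoir are enumerated together and cut at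
    the start of a later block. *)
Lemma state_above s (q : mathias_cond calA) c : mathias_le q (cond s) ->
  exists t, [/\ mathias_le (cond t) q, state_le t s & c <= len t].
Proof.
move=> qs; have [sq qse _ _] := qs; pose x := stem q `|` reservoir q.
have qx : mathias_real q x.
  split=> [|b [[//|//]]]; split=> [b|b e [[//|rb] _] qe]; first by left.
  exact: stem_below qe rb.
have [f fi fx] : exists2 f, increasing f & range f = x.
  apply: (enumeration_exists hK) => a; have [b rb ab] := reservoir_unbounded q a.
  by exists b => //; right.
have enum_stem b : b < start (len s) -> stem (cond s) (enum s b).
  by rewrite stemE => bs; exists b.
have fE : forall b, b < start (len s) -> f b = enum s b.
  apply: (enumeration_unique hK fi) => [b e|b bs|e b bs].
  - exact: enum_lt.
  - by rewrite fx; left; exact/sq/enum_stem.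
  - have [] : x (f e) by rewrite -fx; exists e.
      have [|nse qe] := pselect (stem (cond s) (f e)).
        by rewrite stemE => -[e' ? ?]; exists e'.
      by have [_ /(_ _ _ (conj qe nse) (enum_stem b bs))] := qse; rewrite ltNge => /negP.
    by move=> /(stem_below (sq _ (enum_stem b bs))); rewrite ltNge => /negP.
have [a aP] := stem_bounded q.
(* Taking [l] at least [a] keeps the whole stem of [q], because [f (start l)] is at least [l]. *)
pose l := Order.max (len s) (Order.max c a).
have [sl cl al] : [/\ len s <= l, c <= l & a <= l] by rewrite !le_max !lexx !orbT.
have [|r rq rE] := mathias_cut hK hA (a := f (start l)) qx.
  move=> b /aP /lt_le_trans; apply; apply: le_trans al _.
  exact: (le_trans (le_start l) (increasing_ge hK fi _)).
have rE' : stem r = [set f b | b in [set b | b < start l]].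
  rewrite rE -fx; apply/seteqP; split=> [_ [[b _ <-]]|_ [b bl <-]].
    by rewrite /= increasing_lt // => bl; exists b.
  by split; [exists b|exact: fi].
exists (@State r l f rE' (fun b e be _ => fi b e be)); split=> //; split=> //=.
exact: mathias_le_trans qs.
Qed.

(** Completed blocks are copied; each later block is a sequence of the prescribed colour, found in
    the reservoir above all earlier blocks. *)
Lemma block_realization s v : (forall b, b < len s -> v b = colors (enum s) b) ->
  exists f, [/\ increasing f, forall b, b < start (len s) -> f b = enum s b,
    forall b, start (len s) <= b -> reservoir (cond s) (f b) & colors f = v].
Proof.
move=> vs; have [a0 _] := kappa_inhabited hK.
have [||h hP] := @transfinite_choice _ _ hK (nat -> K) (fun=> a0) (fun b h t =>
  (b < len s -> t = enum s \o pos b) /\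
  (len s <= b -> [/\ increasing_seq t, forall n, reservoir (cond s) (t n), F t = v b &
     forall c n, c < b -> h c n < t 0%N])).
- move=> b h g t hg [t1 t2]; split=> // /t2[t3 t4 t5 t6]; split=> // c n cb.
  by rewrite -hg // t6.
- move=> b h _; have [bs|sb] := ltP b (len s); first by exists (enum s \o pos b).
  have [c cP] := double_bounded hK h b.
  have [|t [ti tA tv]] := F_onto (A := [set e | reservoir (cond s) e /\ c < e]) _ (v b).
    move=> a; have [e re] := reservoir_unbounded (cond s) (Order.max a c).
    by rewrite gt_max => /andP[ae ce]; exists e.
  exists t; split=> // _; split=> // [n|e n /cP/lt_trans]; first by have [] := tA n.
  by apply; have [] := tA 0%N.
have pos_lt a m b n : pos a m < pos b n -> a < b \/ a = b /\ (m < n)%N.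
  move=> mn; have [ab|ba|ab] := ltgtP a b; first by left.
    by move: mn; rewrite ltNge (le_trans (ltW (pos_block n ba)) (start_ge a m)).
  right; split=> //; rewrite ltnNge leq_eqVlt; apply/negP => /orP[/eqP E|].
    by move: mn; rewrite E ab ltxx.
  by move=> /(increasing_seqP (pos_seq b)); rewrite -ab => /lt_trans/(_ mn); rewrite ab ltxx.
have /choice[blk blkP] : forall c, exists p : K * nat, pos p.1 p.2 = c.
  by move=> c; have [a [n an]] := pos_onto c; exists (a, n).
have blkE b n : blk (pos b n) = (b, n).
  have := blkP (pos b n); case: (blk _) => a m /= E.
  have [ab|ba|ab] := ltgtP a b.
  - by have := pos_block m ab; rewrite E ltNge start_ge.
  - by have := pos_block n ba; rewrite -E ltNge start_ge.
  - by rewrite ab; congr pair; apply: (increasing_seq_inj (pos_seq b)); rewrite -E ab.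
pose f c := h (blk c).1 (blk c).2.
have fE b n : f (pos b n) = h b n by rewrite /f blkE.
have hs b n : b < len s -> h b n = enum s (pos b n) by move=> bs; rewrite (hP b).1.
have h_seq b : increasing_seq (h b).
  move=> n; have [bs|sb] := ltP b (len s); last by have [] := (hP b).2 sb.
  by rewrite !hs //; apply: enum_lt; [exact: pos_seq|exact: pos_block].
exists f; split=> [c e|c|c|].
- rewrite -(blkP c) -(blkP e) !fE; move: (blk c) (blk e) => [a m] [b n] /= /pos_lt.
  move=> [ab|[-> mn]]; last exact: (increasing_seqP (h_seq b)).
  have [bs|sb] := ltP b (len s).
    rewrite !hs //; last exact: lt_trans bs.
    apply: enum_lt; last exact: pos_block.
    exact: lt_le_trans (pos_block m ab) (start_ge b n).
  have [_ _ _ H] := (hP b).2 sb; apply: lt_le_trans (H _ _ ab) _.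
  by case: n => // n; apply/ltW/(increasing_seqP (h_seq b)).
- by move=> /lt_startP[b bs [n <-]]; rewrite fE hs.
- rewrite -(blkP c); move: (blk c) => [b n] /= sb; rewrite fE.
  have [bs|{}sb] := ltP b (len s); last by have [] := (hP b).2 sb.
  by move: sb; rewrite leNgt pos_block.
- apply/funext => b; have -> : colors f b = F (h b).
    by congr F; apply/funext => n; exact: fE.
  have [bs|sb] := ltP b (len s); last by have [] := (hP b).2 sb.
  by rewrite (hP b).1 // vs.
Qed.

Lemma state_realize s z c : cone (decided s) z ->
  exists2 t, state_le t s & cone (decided t) `<=` cone (initseg z c).
Proof.
move=> sz; have [a sE] := node_initseg (decided_node s) sz.
pose c1 := Order.max c a.
(* Beyond [c1] everything is put in, which makes the set unbounded; [c1] is past both [c] and the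
   decided part. *)
pose z' := [set b | b < c1 -> z b].
have [g gi gz] : exists2 g, increasing g & range g = z'.
  apply: (enumeration_exists hK) => e; have [b] := exists_gt hK (Order.max e c1).
  by rewrite gt_max => /andP[eb cb]; exists b => // /(lt_trans cb); rewrite ltxx.
pose v := colors (enum s).
have z's b e : b < len s -> e <= G v b -> z' e <-> coded (enum s) e.
  move=> bs eb; have ea : e < a.
    have : isSome (decided s e) by rewrite /decided; case: asboolP => // -[]; exists b.
    by rewrite sE /initseg; case: ifP.
  have ec : e < c1 by rewrite lt_max ea orbT.
  have ze := (cone_decided s z).1 sz b e bs eb.
  by rewrite /z' /= ec ze; split=> [/(_ isT)/asboolP//|/asboolP].
have gG : forall b, b < len s -> g b = G v b.
  apply: (enumeration_unique hK gi) => [b e be _|b bs|e b bs geb].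
  - exact: G_increasing.
  - by rewrite gz; apply/(z's b) => //; exists b.
  - have [|e' _ e'E] := (z's b (g e) bs geb).1; first by rewrite -gz; exists e.
    exists e' => //; apply: le_lt_trans bs; rewrite leNgt; apply/negP.
    by move=> /(G_increasing v); rewrite e'E ltNge geb.
(* Old colours stay and a new block [b] gets the [b]-th element of [z'] as its colour; straightening
   then returns [g]. *)
pose v' b := if b < len s then v b else g b.
have Gv' : forall b, G v' b = g b.
  apply: (well_founded_ind (kappa_wf hK)) => b IH.
  have [bs|sb] := ltP b (len s).
    by rewrite gG //; apply: (@G_local (len s)) => // e es; rewrite /v' es.
  rewrite G_id /v' ltNge sb //= => e eb.
  by rewrite IH // gi.
have [b bs|f [fi fs fr fv]] := @block_realization s v'; first by rewrite /v' bs.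
have sf : mathias_real (cond s) (range f).
  have fstem b : b < start (len s) -> stem (cond s) (f b).
    by move=> bs; rewrite stemE; exists b => //; rewrite fs.
  have fres e : (range f `\` stem (cond s)) e -> reservoir (cond s) e.
    move=> [[b _ <-] nb]; apply: fr; rewrite leNgt; apply/negP => /fstem; exact: nb.
  split=> //; split=> [e|e b /fres re se]; last exact: stem_below re.
  by rewrite stemE => -[b bs <-]; exists b => //; rewrite fs.
pose l := Order.max (len s) c.
have [sl cl] : len s <= l /\ c <= l by rewrite !le_max !lexx !orbT.
have [|r rs rE] := mathias_cut hK hA (a := f (start l)) sf.
  rewrite stemE => _ [b bs <-]; rewrite -fs //.
  exact/fi/(lt_le_trans bs)/start_mono.
have rE' : stem r = [set f b | b in [set b | b < start l]].
  rewrite rE; apply/seteqP; split=> [_ [[b _ <-]]|_ [b bl <-]].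
    by rewrite /= increasing_lt // => bl; exists b.
  by split; [exists b|exact: fi].
exists (@State r l f rE' (fun b e be _ => fi b e be)); first by split.
move=> y /cone_decided /= yt; apply/cone_initseg => e ec.
rewrite (yt e e (lt_le_trans ec cl)); last exact: increasing_ge.
have ec1 : e < c1 by rewrite lt_max ec.
have -> : coded f = z' by rewrite /coded fv -gz (_ : G v' = g) //; apply/funext.
rewrite /z' /= ec1; apply/asboolP/idP => [H|//]; exact: H.
Qed.

(** A lower bound [r] from closedness may have too long a stem. Its stem is replaced by the union of
    the given stems, so that the limit decides nothing new. *)
Lemma state_limit a (S : K -> state) : (exists b, b < a) ->
  (forall b c, b <= c -> c < a -> state_le (S c) (S b)) ->
  exists l, (forall b, b < a -> state_le l (S b)) /\
    forall z, (forall b, b < a -> cone (decided (S b)) z) -> cone (decided l) z.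
Proof.
move=> [b0 b0a] Sdec; have [a0 _] := kappa_inhabited hK.
have [|r rP] := mathias_closed hA (a := a) (f := cond \o S).
  by move=> b c bc ca; have [] := Sdec b c bc ca.
have [|l lP lm] := least_element hK (P := [set l | forall b, b < a -> len (S b) <= l]).
  by have [c cP] := image_bounded hK (len \o S) a; exists c => b /cP/ltW.
have ltl c : c < l -> exists2 b, b < a & c < len (S b).
  move=> cl; apply: contrapT => H; have : l <= c; last by rewrite leNgt cl.
  by apply: lm => b ba; rewrite leNgt; apply/negP => cb; apply: H; exists b.
have lt_start_l c : c < start l -> exists2 b, b < a & c < start (len (S b)).
  by move=> /lt_startP[e /ltl[b ba eb] [n <-]]; exists b => //; exact: pos_block.
have [f fP] : exists f, forall b c, b < a -> c < start (len (S b)) -> f c = enum (S b) c.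
  suff /choice[f fP] : forall c, exists k, forall b, b < a -> c < start (len (S b)) ->
    k = enum (S b) c by exists f => b c; exact: fP.
  move=> c; have [[b ba cb]|nb] := pselect (exists2 b, b < a & c < start (len (S b))); last first.
    by exists a0 => b ba cb; case: nb; exists b.
  exists (enum (S b) c) => e ea ce; have [be|/ltW eb] := leP b e.
    by have [_ _ ->] := Sdec b e be ea.
  by have [_ _ ->] := Sdec e b eb ba.
pose S0 := [set f b | b in [set b | b < start l]].
have sS b : b < a -> stem (cond (S b)) `<=` S0.
  move=> ba; rewrite stemE => _ [c cb <-]; exists c; last exact: fP.
  by apply: lt_le_trans cb _; apply/start_mono/lP.
have S0r : S0 `<=` stem r.
  move=> _ [c /lt_start_l[b ba cb] <-]; have [h _ _ _] := rP b ba; apply: h.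
  by rewrite /= stemE; exists c => //; rewrite (fP b).
have small : ~~ ([set: K] #<= S0).
  by apply: contra (stem_small r) => /card_le_trans; apply; exact: subset_card_le.
have below e b : S0 e -> reservoir r b -> e < b by move=> /S0r; exact: stem_below.
pose p := MathiasCond small (reservoir_in r) below.
have f_lt b c : b < c -> c < start l -> f b < f c.
  move=> bc /lt_start_l[e ea ce]; rewrite !(fP e) ?(lt_trans bc) //; exact: enum_lt.
pose L := @State p l f erefl f_lt; exists L.
have LS b : b < a -> state_le L (S b).
  move=> ba; have [h1 [_ h2] h3 h4] := rP b ba; split=> [|//|c cb]; first last.
  - exact: fP.
  - exact: lP.
  split=> //=; first exact: sS.
    by split=> [|c e [cS nc]]; [exact: sS|apply: h2; split=> //; exact: S0r].
  by move=> c [cS nc]; apply: h4; split=> //; exact: S0r.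
split=> // z zS; apply/cone_decided => /= b c /ltl[e ea be].
have H : forall i, i < len (S e) -> colors f i = colors (enum (S e)) i.
  by apply: colors_local => i ie; exact: fP.
rewrite (G_local H be) => cb.
rewrite ((cone_decided _ _).1 (zS e ea) b c) // /coded.
by symmetry; apply: (G_range_eq H be); rewrite (G_local H be).
Qed.

Lemma fusion_real s (X : K -> set (kreal K bool)) :
  (forall a, forcing_nowhere_dense (mathias calA) (X a)) ->
  exists N : K -> set (kreal K bool),
    (forall a, forcing_nowhere_dense (cohen K) (N a)) /\
    forall z, cone (decided s) z -> ~ (\bigcup_a N a) z ->
    exists2 f, increasing f &
      [/\ branches (mathias_tree (cond s)) (charfun (range f)),
          ~ (\bigcup_a X a) (charfun (range f)) & z = charfun (coded f)].
Proof.
(* Stage [a] avoids [X a] and has length at least [a], so the enumerations have a total function as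
   their union. *)
move=> Xnd; pose Next a t t' := [/\ state_le t' t, a <= len t' &
  branches (mathias_tree (cond t')) `<=` ~` X a].
have [||||a t t' []|a t z c tz||N [Nnd NP]] :=
  @cohen_fusion _ _ hK state state_le decided Next s => //.
- exact: decided_node.
- exact: state_le_refl.
- exact: state_le_trans.
- exact: state_le_cone.
- have [t1 t1t t1z] := state_realize c tz.
  have [q qt1 qX] := Xnd a (cond t1).
  have [t2 [t2q t2t1 at2]] := state_above a qt1.
  exists t2; last by move=> y /(state_le_cone t2t1)/t1z.
  split=> //; first exact: state_le_trans t1t.
  by move=> y /(mathias_le_branches t2q)/qX.
- exact: state_limit.
exists N; split=> // z sz /(NP z sz)[S [Sdec Ss SN Sz]].
have Slen a : a <= len (S a) by have [l []] := SN a.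
have /choice[next nextP] := exists_gt hK.
(* Stage [next c] has length above [c], hence it enumerates position [c] and also decides whether
   [c] is coded. *)
pose f c := enum (S (next c)) c.
have c_next c a : next c <= a -> c < start (len (S a)).
  move=> ca; apply: lt_le_trans (nextP c) _; apply: le_trans ca _.
  exact: le_trans (Slen a) (le_start _).
have fE a c : c < start (len (S a)) -> f c = enum (S a) c.
  move=> ca; rewrite /f; have [na|/ltW an] := leP (next c) a.
    by have [_ _ ->//] := Sdec _ _ na; exact: c_next.
  by have [_ _ ->] := Sdec _ _ an.
have fi : increasing f.
  move=> b c bc; have cS := c_next c _ (lexx _).
  by rewrite (fE _ _ cS) (fE _ _ (lt_trans bc cS)); exact: enum_lt.
have fS a : mathias_real (cond (S a)) (range f).
  have fres e : (range f `\` stem (cond (S a))) e -> reservoir (cond (S a)) e.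
    move=> [[c _ <-] nc]; pose b := Order.max a (next c).
    have ab : a <= b by rewrite le_max lexx.
    have [[_ _ _ h] _ _] := Sdec _ _ ab; apply: h; split=> //.
    rewrite stemE; have cb : c < start (len (S b)) by apply: c_next; rewrite le_max lexx orbT.
    by exists c => //; rewrite -fE.
  split=> //; split=> [e|e b /fres re se]; last exact: stem_below re.
  by rewrite stemE => -[c ca <-]; exists c => //; exact: fE.
have fb a : branches (mathias_tree (cond (S a))) (charfun (range f)).
  exact/mathias_real_branch/fS.
have [a0 _] := kappa_inhabited hK.
exists f => //; split.
- by have [h _ _] := Ss a0; apply: mathias_le_branches h _ (fb a0).
- by move=> [a _ Xa]; have [l [_ _ h]] := SN a; exact: h (fb a) Xa.
apply/funext => c; have nc := lt_le_trans (nextP c) (Slen (next c)).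
have H : forall b, b < len (S (next c)) -> colors (enum (S (next c))) b = colors f b.
  by apply: colors_local => b bS; rewrite -fE.
have cG := increasing_ge hK (G_increasing (colors (enum (S (next c))))) c.
rewrite ((cone_decided _ _).1 (Sz (next c)) c c nc cG) /coded (G_range_eq H nc cG).
by apply/asboolP/idP => [/mem_set|/set_mem].
Qed.

Lemma initial_state : exists s, decided s = fun=> None.
Proof.
have [a0 _] := kappa_inhabited hK.
have [|a _ am] := least_element hK (P := setT); first by exists a0.
have noa b : ~ b < a by rewrite ltNge => /negP; apply; exact: am.
have small : ~~ ([set: K] #<= @set0 K).
  apply: contra (kappa_initial hK a0) => /card_le_trans; apply.
  exact: subset_card_le.
have [A AA] := mathias_nonempty hA.
have below (b c : K) : @set0 K b -> A c -> b < c by [].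
have nos b : ~ b < start a by move=> /lt_startP[c /noa].
have sE : stem (MathiasCond small AA below) = [set b | b in [set b | b < start a]].
  by apply/seteqP; split=> // b [c /nos].
exists (@State _ a id sE (fun b c _ ca => False_ind _ (nos c ca))).
apply/funext => c; rewrite /decided; case: asboolP => // -[b /=]; first by move=> /noa.
Qed.

(** A Mathias condition is first steered into coding [p], and measurability of [Y] is applied there.
    If a Cohen real outside the exceptional sets violated the corresponding alternative for [Z], its
    code would lie in the meager part of [Y] or of its complement while avoiding every set of the
    cover. *)
Lemma cohen_measurable (Y Z : set (kreal K bool)) :
  (forall f, increasing f -> Y (charfun (range f)) <-> Z (charfun (coded f))) ->
  forcing_measurable (mathias calA) Y -> forcing_measurable (cohen K) Z.
Proof.
move=> YZ Ymeas [p pN].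
have [s0 s0E] := initial_state.
pose z0 : kreal K bool := fun b => odflt false (p b).
have pz0 : cone p z0 by move=> b c; rewrite /z0 => ->.
have [c0 pE] := node_initseg pN pz0.
have [|s _ sp] := @state_realize s0 z0 c0; first by rewrite s0E => b c.
have [q qs Yq] := Ymeas (cond s).
have [t [tq ts _]] := state_above c0 qs.
pose z1 : kreal K bool := fun b => odflt false (decided t b).
have tz1 : cone (decided t) z1 by move=> b c; rewrite /z1 => ->.
have [c1 tE] := node_initseg (decided_node t) tz1.
have pz1 : forall b, b < c0 -> z1 b = z0 b.
  exact/cone_initseg/sp/(state_le_cone ts).
pose r : cohen K := exist _ (initseg z1 (Order.max c0 c1)) (initseg_node _ _).
exists r.
  rewrite /= pE => b v; rewrite /initseg; case: ifP => // bc.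
  by rewrite lt_max bc pz1.
have rt : branches (tf_tree r) `<=` cone (decided t).
  rewrite (branches_tree_at hK); last exact: initseg_node.
  move=> y /cone_initseg yz; rewrite tE; apply/cone_initseg => b bc.
  by apply: yz; rewrite lt_max bc orbT.
case: Yq => -[X Xnd XP]; [left|right]; have [N [Nnd NP]] := fusion_real t Xnd;
  exists N => // z [/rt tz Zz]; apply: contrapT => nz;
  have [f fi [ft fX zE]] := NP z tz nz; apply: fX; apply: XP; split;
  try exact: mathias_le_branches tq _ ft.
- by apply/(YZ f fi); rewrite -zE.
- by move=> /(YZ f fi); rewrite -zE.
Qed.
End States.

(** * Transfer of measurability through the code *)

Lemma enumerates_range d (K : orderType d) (hK : uncountable_regular_cardinal K)
    (f g : K -> K) : increasing g ->
  enumerates f (charfun (range g)) <-> f = g.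
Proof.
move=> gi; split=> [[fi fg]|->]; last first.
  split=> // b; rewrite /charfun; split=> [/set_mem[a _ <-]|[a <-]]; first by exists a.
  by apply/mem_set; exists a.
have fg1 b : range g (f b) by apply/set_mem/fg; exists b.
apply/funext => b; have [c bc] := exists_gt hK b; symmetry.
apply: (enumeration_unique hK (f := f) (a := c) gi) => // [e e' ee' _|e e' e'c gf].
  exact: fi.
have [|e2 fe2] := (fg (g e)).1; first by apply/mem_set; exists e.
exists e2 => //; apply: le_lt_trans e'c; rewrite leNgt; apply/negP => /fi.
by rewrite fe2 ltNge gf.
Qed.

Theorem proposition31 (d : Order.disp_t) (K : orderType d)
    (hK : uncountable_regular_cardinal K)
    (hKK : kappa_lt_kappa_eq_kappa K)
    (calA : set (set K)) (hA : mathias_version calA)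
    (G : kfamily K) (hG : topologically_reasonable G) :
  family_measurable G (mathias calA) -> family_baire G.
Proof.
move=> Gmeas l X GX.
have [F Fonto] := universal_coloring hK.
have [pos [pos_seq pos_block pos_onto]] := block_positions hK.
have [g [g_inc g_local g_id]] := straightening hK.
have [a0 _] := kappa_inhabited hK.
(* The source is kappa^kappa for both kinds of [X]; the target receives the coded set or its
   increasing enumeration. *)
pose theta : kreal K K -> kreal K (base_type K l) :=
  match l with
  | Two => fun f => charfun (coded F pos g f)
  | Kappa => fun f => g (colors F pos f)
  end.
have theta_continuous : continuous theta.
  (* The blocks before [b] end below [pos b 0%N], and they determine the code below [b]. *)
  apply: (continuous_kreal a0) => f b; exists (pos b 0%N) => f' ff'.
  have H : forall c, c < b -> colors F pos f' c = colors F pos f c.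
    exact: colors_local.
  move=> c cb; rewrite /theta; case: l {X GX theta} => /=; last exact: g_local H _ cb.
  have cg h : c <= g (colors F pos h) c by exact: (increasing_ge hK (g_inc _)).
  apply/idP/idP => /set_mem cf; apply/mem_set.
    exact: (G_range g_inc g_local H cb (cg f') cf).
  apply: (G_range g_inc g_local _ cb (cg f) cf) => e eb; exact/esym/H.
have := Gmeas Kappa _ (reasonable_preimage hG (l := Kappa) theta_continuous GX).
apply: (cohen_measurable hK hA Fonto pos_seq pos_block pos_onto g_inc g_local g_id).
move=> f fi; have -> : in_cantor (l := Kappa) (theta @^-1` X) (charfun (range f)) <-> X (theta f).
  split=> [[f' Xf' /(enumerates_range hK _ fi) <-//]|Xf].
  by exists f => //; apply/enumerates_range.
rewrite /theta; case: l X GX theta theta_continuous => X GX _ _ //=; split=> [Xf|].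
  by exists (g (colors F pos f)) => //; apply/(enumerates_range hK).
by move=> [h Xh /(enumerates_range hK _ (g_inc _)) <-].
Qed.
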